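(* Consider the randomized gossip model described in the context and assume A1, A2 and A3. Assume that either $T_{k+1}\le T_k$ for all $k$, or $T_{k+1}\ge T_k$ for all $k$. Then: (i) if $\sum_{k=0}^\infty T_k(1-T_k)<\infty$, there is $K_0$ such that for all initial times $k_0\ge K_0$ and Lebesgue-almost every initial value $x(k_0)\in\mathbb R^n$, $\mathbf P(\limsup_{k\to\infty}\mathcal H(k)=0)=0$; (ii) if $\sum_{k=0}^\infty T_k(1-T_k)=\infty$, then $\mathbf P(\limsup_{k\to\infty}\mathcal H(k)=0)=1$ for all initial conditions.
   Context: Network with node set $\mathcal V=\{1,\dots,n\}$, $n\ge 3$. Let $A=[a_{ij}]$ be an $n\times n$ stochastic matrix; the underlying digraph $\mathcal G_0$ has an arc $(j,i)$ iff $a_{ij}>0$. At each time $k=0,1,2,\dots$, independently of the past and of node states, a node $i$ is drawn with probability $1/n$ and then the pair $(i,j)$ is selected with probability $a_{ij}$. Given that pair $(i,j)$ is selected at time $k$, independently of time, node states and pair selection, node $i$: with probability $\alpha$ (event $\mathscr A_{ij}(k)$) sets $x_i(k+1)=(1-T_k)x_i(k)+T_kx_j(k)$, $0<T_k\le1$; with probability $\beta$ (event $\mathscr N_{ij}(k)$) keeps $x_i(k+1)=x_i(k)$; with probability $\gamma$ (event $\mathscr R_{ij}(k)$) sets $x_i(k+1)=(1+S_k)x_i(k)-S_kx_j(k)$, $S_k>0$; $\alpha+\beta+\gamma=1$. Node $j$ updates analogously according to events $\mathscr A_{ji}(k),\mathscr N_{ji}(k),\mathscr R_{ji}(k)$;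 other nodes keep their states. Start at time $k_0\ge0$ from $x(k_0)\in\mathbb R^n$. $\mathcal H(k)=\max_i x_i(k)-\min_i x_i(k)$. A1: $\mathcal G_0$ is weakly connected. A2: $\mathscr R_{ij}(k)$ has probability zero for all $(i,j)$, $k$. A3: $\mathscr A_{ij}(k)=\mathscr A_{ji}(k)$ for all $(i,j)$, $k$.
   Formalization: Part (ii) additionally assumes α > 0: if α = 0 then under A2 no node ever changes its state, so (ii) fails for every initial value whose coordinates are not all equal (e.g. β = 1, T_k = 1/2). *)

(* Defs.v *)
From HB Require Import structures.
From mathcomp Require Import all_boot all_order all_algebra.
From mathcomp Require Import all_classical all_reals all_analysis.
Set Implicit Arguments. Unset Strict Implicit. Unset Printing Implicit Defensive.
Import Order.TTheory GRing.Theory Num.Theory.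
Local Open Scope classical_set_scope.
Local Open Scope ring_scope.

(* Events of a node in an interaction: attraction (A), neglect (N), repulsion (R). *)
Inductive evt := Att | Neg | Rep.

Definition evt_prob {R : realType} (alpha beta gamma : R) (e : evt) : R :=
  match e with Att => alpha | Neg => beta | Rep => gamma end.

(* The random outcome drawn at one time step:
   (i, j, ev) = selected node i, its partner j, and the node events
   ev i' j' for every ordered pair (ev i j = event of node i when the pair
   (i,j) interacts, i.e. which of A_ij(k), N_ij(k), R_ij(k) occurs). *)
Definition Step (n : nat) : Type := ('I_n * 'I_n * ('I_n -> 'I_n -> evt))%type.

Definition step_node n (z : Step n) : 'I_n := z.1.1.
Definition step_partner n (z : Step n) : 'I_n := z.1.2.
Definition step_ev n (z : Step n) : 'I_n -> 'I_n -> evt := z.2.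

Definition stochastic {R : realType} n (A : 'M[R]_n) : Prop :=
  (forall i j, 0 <= A i j) /\ (forall i, \sum_(j < n) A i j = 1).

Definition weakly_connected {R : realType} n (A : 'M[R]_n) : Prop :=
  forall u v : 'I_n, connect [rel i j | (0 < A i j) || (0 < A j i)] u v.

Definition upd {R : realType} (Tk Sk : R) (e : evt) (xi xj : R) : R :=
  match e with
  | Att => (1 - Tk) * xi + Tk * xj
  | Neg => xi
  | Rep => (1 + Sk) * xi - Sk * xj
  end.

Definition gossip_step {R : realType} n (T S : nat -> R) (k : nat) (z : Step n)
    (x : 'I_n -> R) : 'I_n -> R :=
  fun m =>
    let i := step_node z in let j := step_partner z in
    if m == i then upd (T k) (S k) (step_ev z i j) (x i) (x j)
    else if m == j then upd (T k) (S k) (step_ev z j i) (x j) (x i)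
    else x m.

(* traj T S Z k0 x0 w m = x(k0 + m) for the sample point w, started at
   time k0 from x(k0) = x0. *)
Fixpoint traj {R : realType} n (T S : nat -> R) {Omega : Type}
    (Z : nat -> Omega -> Step n) (k0 : nat) (x0 : 'I_n -> R) (w : Omega)
    (m : nat) : 'I_n -> R :=
  match m with
  | 0 => x0
  | m'.+1 => gossip_step T S (k0 + m') (Z (k0 + m') w) (traj T S Z k0 x0 w m')
  end.

(* H = max_i x_i - min_i x_i  (n >= 3 so the list is nonempty). *)
Definition Hdiam {R : realType} n (x : 'I_n -> R) : R :=
  let s := [seq x i | i <- enum 'I_n] in
  \big[Num.max/head 0 s]_(v <- s) v - \big[Num.min/head 0 s]_(v <- s) v.

Definition mutually_independent {R : realType} {d} {Omega : measurableType d}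
    (P : probability Omega R) n (Z : nat -> Omega -> Step n) : Prop :=
  forall (s : seq nat), uniq s -> forall B : nat -> set (Step n),
    P (\big[setI/setT]_(k <- s) (Z k @^-1` B k)) =
    (\prod_(k <- s) P (Z k @^-1` B k))%E.

Definition box {R : realType} n (a b : 'I_n -> R) : set ('I_n -> R) :=
  [set x | forall i, a i <= x i <= b i].

Definition lebesgue_null {R : realType} n (N : set ('I_n -> R)) : Prop :=
  forall eps : R, 0 < eps ->
  exists a b : nat -> 'I_n -> R,
    (forall k i, a k i <= b k i) /\
    N `<=` \bigcup_k box (a k) (b k) /\
    (forall N : nat, \sum_(k < N) \prod_(i < n) (b k i - a k i) <= eps).

Definition ae_lebesgue {R : realType} n (Q : ('I_n -> R) -> Prop) : Prop :=
  lebesgue_null [set x | ~ Q x].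

(* Main.v *)
(* Let V(x) be the sum of (x_u - x_v)^2 over all pairs of nodes; it is comparable
   to the squared diameter. A symmetric attraction of the pair (i, j) preserves
   the sum of the states and decreases V by exactly 4 n T (1 - T) (x_i - x_j)^2,
   so the squared differences drive everything and monotone step sizes play no
   role.
   (i) Since (x_i - x_j)^2 <= V / 2, almost surely
   V(k+1) >= (1 - 2 n T_k (1 - T_k)) V(k). Once the tail of the series is at most
   1 / (4 n), V never falls below half its initial value, which is positive off
   the diagonal, a Lebesgue null set.
   (ii) By weak connectivity, V is at most a multiple of the sum of
   a_ij (x_i - x_j)^2, hence E V(k+1) <= (1 - kappa T_k (1 - T_k)) E V(k) for some
   kappa > 0, and the divergence of the series gives E V(k) -> 0. As V is almost
   surely nonincreasing, Markov's inequality yields V -> 0 almost surely. *)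
Require Import Defs.
From HB Require Import structures.
From mathcomp Require Import all_boot all_order all_algebra.
From mathcomp Require Import ring lra.
From mathcomp Require Import all_classical all_reals all_analysis.
From mathcomp Require Import measurable_realfun.
Import Order.TTheory GRing.Theory Num.Theory.
Local Open Scope classical_set_scope.
Local Open Scope ring_scope.

(** * Finite outcomes of one interaction *)

Definition evt_code (e : evt) : option bool :=
  match e with Att => Some true | Neg => Some false | Rep => None end.

Definition evt_decode (b : option bool) : evt :=
  match b with Some true => Att | Some false => Neg | None => Rep end.

Lemma evt_codeK : cancel evt_code evt_decode.
Proof. by case. Qed.

HB.instance Definition _ := Finite.copy evt (can_type evt_codeK).

(** A step acts only through the selected pair and its two events; keeping just these gives a finite
    type, so averages over a step become finite sums. *)
Definition outcome (n : nat) : finType := ('I_n * 'I_n * (evt * evt))%type.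

Definition outcome_of {n} (z : Step n) : outcome n :=
  (step_node z, step_partner z,
   (step_ev z (step_node z) (step_partner z),
    step_ev z (step_partner z) (step_node z))).

Definition outcome_step {R : realType} {n} (Tk Sk : R) (c : outcome n)
    (x : 'I_n -> R) : 'I_n -> R :=
  fun m =>
    if m == c.1.1 then upd Tk Sk c.2.1 (x c.1.1) (x c.1.2)
    else if m == c.1.2 then upd Tk Sk c.2.2 (x c.1.2) (x c.1.1)
    else x m.

Lemma gossip_stepE {R : realType} {n} (T S : nat -> R) k (z : Step n) x :
  gossip_step T S k z x = outcome_step (T k) (S k) (outcome_of z) x.
Proof. by []. Qed.

(** The outcomes compatible with A2 and A3: both nodes attract or both neglect. *)
Definition admissible {n} (c : outcome n) : bool :=
  (c.2.1 == c.2.2) && (c.2.1 != Rep).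

(** * The quadratic Lyapunov function *)

Definition spread {R : realType} {n} (x : 'I_n -> R) : R :=
  \sum_u \sum_v (x u - x v) ^+ 2.

(** A symmetric attraction preserves [\sum_u x u], so in this form only the sum of squares can
    change. *)
Lemma spreadE {R : realType} {n} (x : 'I_n -> R) :
  spread x = 2 * n%:R * (\sum_u x u ^+ 2) - 2 * (\sum_u x u) ^+ 2.
Proof.
have row u : \sum_v (x u - x v) ^+ 2 =
    n%:R * x u ^+ 2 - 2 * x u * (\sum_v x v) + \sum_v x v ^+ 2.
  under eq_bigr => v _ do rewrite sqrrB.
  rewrite big_split sumrB /= sumr_const card_ord sumrMnl -mulr_sumr.
  by ring.
rewrite /spread; under eq_bigr => u _ do rewrite row.
rewrite big_split sumrB /= sumr_const card_ord -mulr_sumr -mulr_suml -mulr_sumr.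
ring.
Qed.

Lemma spread_ge0 {R : realType} {n} (x : 'I_n -> R) : 0 <= spread x.
Proof. by apply: sumr_ge0 => u _; apply: sumr_ge0 => v _; apply: sqr_ge0. Qed.

Lemma sqr_diff_le_spread {R : realType} {n} (x : 'I_n -> R) u v :
  2 * (x u - x v) ^+ 2 <= spread x.
Proof.
have [->|uv] := eqVneq u v.
  by rewrite subrr expr0n mulr0 spread_ge0.
rewrite /spread (bigD1 u)//= (bigD1 v) 1?eq_sym//= mulr_natl mulr2n -addrA.
rewrite lerD2l -[leLHS]add0r; apply: lerD.
  by apply: sumr_ge0 => w _; apply: sqr_ge0.
rewrite (bigD1 v) 1?eq_sym//= (bigD1 u)//= -[leLHS]addr0 -addrA; apply: lerD.
  by rewrite -(opprB (x u)) sqrrN.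
apply: addr_ge0; first by apply: sumr_ge0 => w _; apply: sqr_ge0.
by apply: sumr_ge0 => a _; apply: sumr_ge0 => b _; apply: sqr_ge0.
Qed.

(** Attraction keeps [x i + x j] and scales [x i - x j] by [1 - 2 * Tk], so the two squares lose
    [2 * Tk * (1 - Tk) * (x i - x j) ^+ 2]; [spreadE] multiplies this by [2 * n]. *)
Lemma spread_outcome_step {R : realType} {n} (Tk Sk : R) (c : outcome n)
    (x : 'I_n -> R) : admissible c ->
  spread (outcome_step Tk Sk c x) =
  spread x - (c.2.1 == Att)%:R *
    (4 * n%:R * (Tk * (1 - Tk)) * (x c.1.1 - x c.1.2) ^+ 2).
Proof.
case: c => -[i j] [e e']; rewrite /admissible /= => /andP[/eqP <-{e'} eR].
case: e eR => // _; rewrite ?eqxx ?mul1r; last first.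
  rewrite mul0r subr0; congr spread; apply/funext => m.
  by rewrite /outcome_step /=; do 2?case: eqP => [->//|_].
(* A node may select itself, since [A i i] may be positive; its state is then unchanged. *)
have [<-{j}|ij] := eqVneq i j.
  rewrite subrr expr0n mulr0 subr0; congr spread; apply/funext => m.
  by rewrite /outcome_step /=; case: eqP => [->|//]; ring.
rewrite !spreadE.
have split2 (F : R -> R) y : \sum_u F (y u) =
    F (y i) + F (y j) + \sum_(u < n | (u != i) && (u != j)) F (y u) :> R.
  by rewrite (bigD1 i)//= (bigD1 j) 1?eq_sym//= addrA.
rewrite !(split2 (fun z => z ^+ 2)) !(split2 id) /=.
rewrite /outcome_step /= !eqxx [j == i]eq_sym (negPf ij).
under eq_bigr => u /andP[ui uj] do rewrite (negPf ui) (negPf uj).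
under [\sum_(i0 < n | _) (if _ then _ else _)]eq_bigr => u /andP[ui uj] do
  rewrite (negPf ui) (negPf uj).
ring.
Qed.

(** Each edge difference is controlled through the inverse of its positive weight; along an
    undirected path these bounds chain by [(a + b)^2 <= 2 a^2 + 2 b^2]. *)
Lemma spread_le_sum_edges {R : realType} {n} (A : 'M[R]_n) :
  stochastic A -> weakly_connected A ->
  exists2 C : R, 0 < C &
    forall x : 'I_n -> R,
      spread x <= C * \sum_i \sum_j A i j * (x i - x j) ^+ 2.
Proof.
move=> [A0 _] Aconn.
pose Q x := \sum_i \sum_j A i j * (x i - x j) ^+ 2.
have Q0 x : 0 <= Q x.
  by apply: sumr_ge0 => i _; apply: sumr_ge0 => j _; rewrite mulr_ge0 ?sqr_ge0.
have QA x i j : A i j * (x i - x j) ^+ 2 <= Q x.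
  have pos k l : 0 <= A k l * (x k - x l) ^+ 2 by rewrite mulr_ge0 ?sqr_ge0.
  rewrite /Q (bigD1 i)//= (bigD1 j)//= -addrA lerDl addr_ge0//.
    by apply: sumr_ge0.
  by apply: sumr_ge0 => k _; apply: sumr_ge0.
have edge i j : (0 < A i j) || (0 < A j i) ->
    exists2 C : R, 0 <= C & forall x, (x i - x j) ^+ 2 <= C * Q x.
  case/orP => Aij.
    exists (A i j)^-1; first by rewrite invr_ge0 ltW.
    by move=> x; rewrite ler_pdivlMl// QA.
  exists (A j i)^-1; first by rewrite invr_ge0 ltW.
  by move=> x; rewrite ler_pdivlMl// -(opprB (x j)) sqrrN QA.
have pair (u v : 'I_n) : exists C : R,
    0 <= C /\ forall x, (x u - x v) ^+ 2 <= C * Q x.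
  have /connectP[p] := Aconn u v.
  elim: p u => [|w p IH] u /=.
    by move=> _ ->; exists 0; split => // x; rewrite subrr expr0n mul0r.
  move=> /andP[/edge[C1 C10 uw]] /IH /[apply] -[C2 [C20 wv]].
  exists (2 * C1 + 2 * C2); split; first by rewrite addr_ge0 ?mulr_ge0.
  (* The square is [(a - b)^2] for [a = x u - x w] and [b = x w - x v], that is, the slack in the
     chaining inequality. *)
  move=> x; have := uw x; have := wv x; have := sqr_ge0 (x u - 2 * x w + x v).
  by lra.
pose c u v : R := projT1 (cid (pair u v)).
have c0 u v : 0 <= c u v by rewrite /c; case: cid => C [].
have cQ u v x : (x u - x v) ^+ 2 <= c u v * Q x by rewrite /c; case: cid => C [].
(* The summand 1 makes the constant strictly positive. *)
exists (1 + \sum_u \sum_v c u v).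
  by rewrite ltr_pwDl// sumr_ge0// => u _; apply: sumr_ge0.
move=> x; rewrite -/(Q x) mulrDl mul1r -[leLHS]add0r lerD//.
rewrite mulr_suml; apply: ler_sum => u _; rewrite mulr_suml.
by apply: ler_sum => v _.
Qed.

(** * Diameter versus spread *)

Lemma bigmax_seq_mem {R : realType} (a : R) (s : seq R) :
  \big[Num.max/a]_(v <- s) v \in a :: s.
Proof.
elim: s => [|b s IH]; first by rewrite big_nil mem_head.
by rewrite big_cons !inE; case: leP; move: IH; rewrite !inE => /orP[] H;
  rewrite ?H ?eqxx ?orbT.
Qed.

Lemma bigmin_seq_mem {R : realType} (a : R) (s : seq R) :
  \big[Num.min/a]_(v <- s) v \in a :: s.
Proof.
elim: s => [|b s IH]; first by rewrite big_nil mem_head.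
by rewrite big_cons !inE; case: leP; move: IH; rewrite !inE => /orP[] H;
  rewrite ?H ?eqxx ?orbT.
Qed.

Lemma le_bigmax_seq_mem {R : realType} (a : R) (s : seq R) b :
  b \in s -> b <= \big[Num.max/a]_(v <- s) v.
Proof.
elim: s => [//|c s IH]; rewrite inE big_cons le_max => /orP[/eqP->|/IH ->].
  by rewrite lexx.
by rewrite orbT.
Qed.

Lemma bigmin_seq_mem_le {R : realType} (a : R) (s : seq R) b :
  b \in s -> \big[Num.min/a]_(v <- s) v <= b.
Proof.
elim: s => [//|c s IH]; rewrite inE big_cons ge_min => /orP[/eqP->|/IH ->].
  by rewrite lexx.
by rewrite orbT.
Qed.

Section diameter.
Context {R : realType} {n : nat} (x : 'I_n -> R).

Lemma diff_le_Hdiam i j : x i - x j <= Hdiam x.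
Proof.
apply: lerB; [apply: le_bigmax_seq_mem|apply: bigmin_seq_mem_le].
  by apply: map_f; rewrite mem_enum.
by apply: map_f; rewrite mem_enum.
Qed.

Hypothesis n0 : (0 < n)%N.

Lemma Hdiam_attained : exists i j, Hdiam x = x i - x j.
Proof.
rewrite /Hdiam; set s := [seq x i | i <- enum 'I_n].
(* The default value of both extrema is the head of [s], itself a state because [0 < n]. *)
have hs b : b \in head 0 s :: s -> exists i, b = x i.
  have : s != [::] by rewrite -size_eq0 size_map size_enum_ord -lt0n.
  case E : s => [//|c t] _; rewrite inE -E => bs.
  have {bs} : b \in s by case/orP: bs => [/eqP->|//]; rewrite E mem_head.
  by move=> /mapP[i _ ->]; exists i.
have [i ->] := hs _ (bigmax_seq_mem _ _).
by have [j ->] := hs _ (bigmin_seq_mem _ _); exists i, j.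
Qed.

Lemma Hdiam_ge0 : 0 <= Hdiam x.
Proof. by rewrite (le_trans _ (diff_le_Hdiam (Ordinal n0) (Ordinal n0)))// subrr. Qed.

Lemma Hdiam_sqr_le_spread : Hdiam x ^+ 2 <= spread x.
Proof.
have [i [j ->]] := Hdiam_attained.
by have := sqr_diff_le_spread x i j; have := sqr_ge0 (x i - x j); lra.
Qed.

Lemma spread_le_Hdiam_sqr : spread x <= n%:R ^+ 2 * Hdiam x ^+ 2.
Proof.
have uv u v : (x u - x v) ^+ 2 <= Hdiam x ^+ 2.
  rewrite -(real_normK (num_real (x u - x v))) lerXn2r ?nnegrE ?Hdiam_ge0//.
  by rewrite ler_norml lerNl opprB !diff_le_Hdiam.
have -> : n%:R ^+ 2 * Hdiam x ^+ 2 =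
    \sum_(u < n) \sum_(v < n) (Hdiam x ^+ 2).
  by rewrite !sumr_const !card_ord; ring.
by apply: ler_sum => u _; apply: ler_sum.
Qed.

End diameter.

(** * Expectation along a chain with finitely many outcomes per step *)

(** Backward recursion for the mean of [g] after [m] independent steps with weights [p]: the last
    step is averaged into the test function first, which replaces conditional expectations. *)
Fixpoint expect {R : realType} {C : finType} {S : Type} (p : nat -> C -> R)
    (f : nat -> C -> S -> S) (k0 : nat) (x0 : S) (m : nat) (g : S -> R) : R :=
  match m with
  | 0 => g x0
  | m'.+1 =>
      expect p f k0 x0 m'
        (fun x => \sum_c p (k0 + m')%N c * g (f (k0 + m')%N c x))
  end.

Section expect_theory.
Context {R : realType} {C : finType} {S : Type} (p : nat -> C -> R)
  (f : nat -> C -> S -> S) (k0 : nat) (x0 : S).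

Lemma expect_sum m (I : finType) (a : I -> R) (g : I -> S -> R) :
  expect p f k0 x0 m (fun x => \sum_i a i * g i x) =
  \sum_i a i * expect p f k0 x0 m (g i).
Proof.
elim: m g => [//|m IH] g /=; rewrite -IH; congr expect; apply/funext => x.
under eq_bigr => c _ do rewrite mulr_sumr.
rewrite exchange_big /=; apply: eq_bigr => i _; rewrite mulr_sumr.
by apply: eq_bigr => c _; rewrite mulrCA.
Qed.

Lemma expectZ m a (g : S -> R) :
  expect p f k0 x0 m (fun x => a * g x) = a * expect p f k0 x0 m g.
Proof.
have := expect_sum m 'I_1 (fun=> a) (fun=> g).
by rewrite big_ord1 => <-; congr expect; apply/funext => x; rewrite big_ord1.
Qed.

Lemma le_expect m (g h : S -> R) : (forall k c, 0 <= p k c) ->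
  (forall x, g x <= h x) -> expect p f k0 x0 m g <= expect p f k0 x0 m h.
Proof.
move=> p0; elim: m g h => [g h /(_ x0)//|m IH g h gh] /=; apply: IH => x.
by apply: ler_sum => c _; apply: ler_wpM2l.
Qed.

End expect_theory.

(** * Law of the random trajectory *)

Section trajectory.
Context {R : realType} {n : nat} (T Srep : nat -> R) {d : measure_display}
  {Omega : measurableType d} (P : probability Omega R)
  (Z : nat -> Omega -> Step n).
Hypothesis mZ : forall k (B : set (Step n)), measurable (Z k @^-1` B).

Definition outcome_event (c : outcome n) : set (Step n) :=
  [set z | outcome_of z = c].

Definition outcome_prob (k : nat) (c : outcome n) : R :=
  fine (P (Z k @^-1` outcome_event c)).

Lemma outcome_probE k c :
  P (Z k @^-1` outcome_event c) = (outcome_prob k c)%:E.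
Proof. by rewrite fineK// fin_num_measure. Qed.

Lemma outcome_prob_ge0 k c : 0 <= outcome_prob k c.
Proof. exact: fine_ge0. Qed.

Lemma measure_outcome_split k (E : set Omega) : measurable E ->
  P E = (\sum_(c : outcome n) P (E `&` Z k @^-1` outcome_event c))%E.
Proof.
move=> mE.
have {1}-> : E = \bigcup_(c in [set: outcome n]) (E `&` Z k @^-1` outcome_event c).
  by apply/seteqP; split=> [w Ew|w [c _ []]//]; exists (outcome_of (Z k w)).
rewrite measure_fin_bigcup//.
- have -> : [set: outcome n] = [set` enum (outcome n)].
    by apply/seteqP; split=> c //= _; rewrite mem_enum.
  by rewrite -fsbig_seq ?enum_uniq// big_enum.
- exact: finite_finset.
- by move=> c c' _ _ [w [[_ <-] [_ <-]]].
- by move=> c _; apply: measurableI.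
Qed.

Lemma outcome_prob_sum1 k : \sum_c outcome_prob k c = 1.
Proof.
apply/EFin_inj; rewrite -sumEFin -(probability_setT P).
rewrite (measure_outcome_split k)//; apply: eq_bigr => c _.
by rewrite setTI outcome_probE.
Qed.

Context (k0 : nat) (x0 : 'I_n -> R).

Definition in_traj (B : set ('I_n -> R)) (m : nat) : set Omega :=
  [set w | B (traj T Srep Z k0 x0 w m)].

Let step k := @outcome_step R n (T k) (Srep k).

(** Once the last outcome is fixed, an event about the new state pulls back to one about the
    previous state, matching the recursion of [expect]. *)
Lemma in_trajS B m c :
  in_traj B m.+1 `&` Z (k0 + m)%N @^-1` outcome_event c =
  in_traj (step (k0 + m)%N c @^-1` B) m `&` Z (k0 + m)%N @^-1` outcome_event c.
Proof.
by apply/seteqP; split=> w /=; rewrite /in_traj /= gossip_stepE => -[Bw cw];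
  split => //; move: Bw; rewrite cw.
Qed.

Lemma measurable_in_traj B m : measurable (in_traj B m).
Proof.
elim: m B => [|m IH] B.
  have [Bx|Bx] := pselect (B x0).
    by rewrite (_ : in_traj B 0 = setT)//; apply/seteqP; split.
  by rewrite (_ : in_traj B 0 = set0)//; apply/seteqP; split.
have -> : in_traj B m.+1 = \bigcup_(c in [set: outcome n])
    (in_traj B m.+1 `&` Z (k0 + m)%N @^-1` outcome_event c).
  apply/seteqP; split=> [w Bw|w [c _ []]//].
  by exists (outcome_of (Z (k0 + m)%N w)).
apply: fin_bigcup_measurable => [|c _]; first exact: finite_finset.
by rewrite in_trajS; apply: measurableI.
Qed.

Lemma measurable_limn_esup_Hdiam :
  measurable [set w |
    limn_esup (fun m => (Hdiam (traj T Srep Z k0 x0 w m))%:E) = 0%E].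
Proof.
have mlim : measurable_fun setT
    (fun w => limn_esup (fun m => (Hdiam (traj T Srep Z k0 x0 w m))%:E)).
  apply: measurable_fun_limn_esup => m _ Y _.
  rewrite setTI; exact: (measurable_in_traj (fun x => Y (Hdiam x)%:E)).
rewrite -[X in measurable X]setTI.
exact: (mlim measurableT [set 0%E] (emeasurable_set1 0%E)).
Qed.

Hypothesis indep : mutually_independent P Z.

(* Conditions on the steps after time [k0 + m] are carried along so that the
   induction on [m] can absorb the outcome at time [k0 + m] into them. *)
Lemma prob_in_traj_and_future B m (s : seq nat) (D : nat -> set (Step n)) :
  uniq s -> all (leq (k0 + m)) s ->
  P (in_traj B m `&` \big[setI/setT]_(k <- s) (Z k @^-1` D k)) =
  ((expect outcome_prob step k0 x0 m \1_B)%:E *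
   \prod_(k <- s) P (Z k @^-1` D k))%E.
Proof.
elim: m B s D => [|m IH] B s D us sm.
  rewrite -indep// /= indicE; have [Bx|Bx] := pselect (B x0).
    rewrite mem_set// mul1e (_ : in_traj B 0 = setT) ?setTI//.
    by apply/seteqP; split.
  rewrite memNset// mul0e (_ : in_traj B 0 = set0) ?set0I ?measure0//.
  by apply/seteqP; split.
have ms : (k0 + m)%N \notin s.
  by apply/negP => /(allP sm); rewrite addnS ltnn.
have mD : measurable (\big[setI/setT]_(k <- s) (Z k @^-1` D k)).
  by elim/big_ind: _ => //; apply: measurableI.
(* By independence the product is a probability, hence finite, and the computation can move to
   [R]. *)
have [q qE] : exists q, (\prod_(k <- s) P (Z k @^-1` D k))%E = q%:E.
  by rewrite -indep//; exists (fine (P (\big[setI/setT]_(k <- s) (Z k @^-1` D k))));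
    rewrite fineK// fin_num_measure.
rewrite (measure_outcome_split (k0 + m)%N); last first.
  by apply: measurableI => //; apply: measurable_in_traj.
rewrite qE -EFinM /= expect_sum mulr_suml -sumEFin; apply: eq_bigr => c _.
pose D' k := if k == (k0 + m)%N then outcome_event c else D k.
have D'D k : k \in s -> D' k = D k.
  by rewrite /D'; case: eqP => [->|//]; rewrite (negPf ms).
rewrite setIAC in_trajS -setIA.
have -> : Z (k0 + m)%N @^-1` outcome_event c `&`
    \big[setI/setT]_(k <- s) (Z k @^-1` D k) =
    \big[setI/setT]_(k <- (k0 + m)%N :: s) (Z k @^-1` D' k).
  rewrite big_cons {1}/D' eqxx; congr (_ `&` _).
  by apply: eq_big_seq => k /D'D ->.
rewrite IH /= ?ms ?leqnn//=; last first.
  by apply: sub_all sm => k; apply: leq_trans; rewrite leq_add2l.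
rewrite big_cons {1}/D' eqxx outcome_probE.
rewrite (eq_big_seq (fun k => P (Z k @^-1` D k))); last by move=> k /D'D ->.
rewrite qE -!EFinM; congr EFin; rewrite mulrA; congr (_ * _); rewrite mulrC.
by congr (_ * _); congr expect; apply/funext => x; rewrite /= !indicE.
Qed.

Lemma prob_in_traj B m :
  P (in_traj B m) = (expect outcome_prob step k0 x0 m \1_B)%:E.
Proof.
have := prob_in_traj_and_future B m [::] (fun=> setT) isT isT.
by rewrite !big_nil setIT mule1.
Qed.

(** Markov's inequality, from the pointwise bound of the indicator by [eps^-1 * V]. *)
Lemma traj_markov (V : ('I_n -> R) -> R) m eps : (forall x, 0 <= V x) ->
  0 < eps ->
  (P (in_traj [set x | (eps <= V x)%R] m) <=
   (eps^-1 * expect outcome_prob step k0 x0 m V)%R%:E)%E.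
Proof.
move=> V0 eps0; rewrite prob_in_traj lee_fin -expectZ.
apply: le_expect => [k c|x]; first exact: outcome_prob_ge0.
rewrite indicE; case: (boolP (x \in _)) => [|_] /=.
  by rewrite inE /= ler_pdivlMl// mulr1.
by rewrite mulr_ge0// invr_ge0 ltW.
Qed.

End trajectory.

(** * Blocks of convergent and divergent series *)

Lemma nneseries_tail_le {R : realType} (t : nat -> R) (eps : R) :
  (forall k, 0 <= t k) -> 0 < eps ->
  (\sum_(0 <= k <oo) (t k)%:E < +oo)%E ->
  exists K0, forall k0 m, (K0 <= k0)%N -> \sum_(k0 <= k < k0 + m) t k <= eps.
Proof.
move=> t0 eps0 /nneseries_tail_cvg tail.
have {}tail := tail (fun k _ => t0 k : (0 <= (t k)%:E)%E).
have /tail[K0 _ HK] : nbhs (0%E : \bar R) [set y | (y < eps%:E)%E].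
  by apply: lt_nbhsl; exact: eps0.
exists K0 => k0 m K0k; rewrite -lee_fin -sumEFin.
apply: le_trans (ltW (HK k0 K0k)).
by apply: nneseries_lim_ge => k _ _; rewrite lee_fin.
Qed.

Lemma nneseries_dvg_ge {R : realType} (t : nat -> R) (b : R) k0 :
  (forall k, 0 <= t k) -> (\sum_(0 <= k <oo) (t k)%:E = +oo)%E ->
  exists m, b <= \sum_(k0 <= k < k0 + m) t k.
Proof.
move=> t0 too; apply: contrapT => /forallNP tb.
have tE k : (0 <= (t k)%:E)%E by rewrite lee_fin.
have tail : (\sum_(k0 <= k <oo) (t k)%:E <= b%:E)%E.
  apply: lime_le; first by apply: is_cvg_nneseries.
  near=> m; have km : (k0 <= m)%N by near: m; exact: nbhs_infty_ge.
  rewrite sumEFin lee_fin -(subnKC km); apply/ltW.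
  by rewrite real_ltNge ?num_real//; apply/negP/tb.
move: too; rewrite (nneseries_split 0 k0)// add0n sumEFin => too.
have : (+oo <= (\sum_(0 <= k < k0) t k)%:E + b%:E :> \bar R)%E.
  by rewrite -too leeD2l.
by rewrite -EFinD.
Unshelve. all: by end_near.
Qed.

(** * The diagonal is Lebesgue null *)

Lemma sum_inv_sqr_le {R : realType} N :
  \sum_(k < N) (k.+1%:R ^+ 2)^-1 <= 2 - N%:R^-1 :> R.
Proof.
(* Telescoping with [1/(N+2)^2 <= 1/(N+1) - 1/(N+2)] starts from one term; the empty sum is separate
   because [0^-1 = 0]. *)
elim: N => [|[|N] IH]; first by rewrite big_ord0 invr0 subr0.
  by rewrite big_ord_recr big_ord0 /= expr1n invr1; lra.
rewrite big_ord_recr /= (le_trans (lerD IH (lexx _)))//.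
have N0 : 0 <= N%:R :> R by [].
suff : (N.+2%:R ^+ 2)^-1 <= N.+1%:R^-1 - N.+2%:R^-1 :> R.
  by move: ((_ ^+ 2)^-1) (N.+1%:R^-1) (N.+2%:R^-1) => a b c; lra.
rewrite -(natr1 N.+1) -(natr1 N).
have -> : (N%:R + 1)^-1 - (N%:R + 1 + 1)^-1 =
    ((N%:R + 1) * (N%:R + 1 + 1))^-1 :> R.
  by field; apply/andP; split; rewrite gt_eqF//; lra.
by rewrite lef_pV2 ?posrE ?expr2; nra.
Qed.

Lemma harmonic_unbounded {R : realType} (b : R) :
  exists N, b < \sum_(k < N) (k.+1%:R)^-1.
Proof.
apply: contrapT => /forallNP bH; apply: (@dvg_harmonic R).
apply: nondecreasing_is_cvgn.
  by apply: nondecreasing_series => k _ _; apply: harmonic_ge0.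
exists b => _ [N _ <-]; rewrite leNgt; apply/negP; move: (bH N).
by rewrite seriesEord.
Qed.

(* The diagonal is covered by cubes whose sides are proportional to the terms of
   the harmonic series: it diverges, while the volumes are summable. *)
Lemma lebesgue_null_diagonal {R : realType} n : (1 < n)%N ->
  lebesgue_null [set x : 'I_n -> R | forall i j, x i = x j].
Proof.
move=> n1 eps eps0.
(* The volumes will sum to at most [4 * dl ^+ 2 * 2], which is at most [8 * dl <= eps] as
   [dl <= 1]. *)
pose dl : R := Num.min 1 (eps / 8).
have dl0 : 0 < dl by rewrite lt_min ltr01 divr_gt0.
have dl1 : dl <= 1 by rewrite ge_min lexx.
have dle : 8 * dl <= eps.
  by rewrite mulrC -ler_pdivlMr// ge_min lexx orbT.
pose s j : R := dl * \sum_(k < j) (k.+1%:R)^-1.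
have sS j : s j.+1 = s j + dl / j.+1%:R by rewrite /s big_ord_recr mulrDr.
have width0 j : 0 <= dl / j.+1%:R by rewrite divr_ge0// ltW.
(* With [j = k./2], even indices give the cube over [[s j, s j.+1]] and odd indices its mirror
   image. *)
exists (fun k _ => if odd k then - s k./2.+1 else s k./2).
exists (fun k _ => if odd k then - s k./2 else s k./2.+1).
split; last split.
- move=> k _; have := width0 k./2; rewrite sS.
  by move: (s _) (dl / _) => u v; case: odd; lra.
- move=> x xE; pose t := x (Ordinal (ltnW n1)).
  have xt i : x i = t by apply: xE.
  have [j /andP[sj jS]] : exists j, s j <= `|t| <= s j.+1.
    have [N HN] := harmonic_unbounded (`|t| / dl).
    have exN : exists N, `|t| < s N.
      by exists N; rewrite /s mulrC -ltr_pdivrMr.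
    case: (ex_minnP exN) => -[|j] tj jmin.
      by move: tj; rewrite /s big_ord0 mulr0 ltNge normr_ge0.
    exists j; rewrite (ltW tj) andbT leNgt; apply/negP => /jmin.
    by rewrite ltnn.
  have [t0|t0] := leP 0 t.
    exists j.*2 => // i; rewrite odd_double doubleK xt.
    by rewrite -{1 2}(ger0_norm t0) sj.
  exists j.*2.+1 => // i; rewrite /= odd_double uphalf_double xt.
  by move: sj jS; rewrite ltr0_norm// => sj jS; rewrite lerNl jS lerNr.
- move=> N.
  have vol k : \prod_(i < n) ((if odd k then - s k./2 else s k./2.+1) -
      (if odd k then - s k./2.+1 else s k./2)) <=
      4 * dl ^+ 2 * (k.+1%:R ^+ 2)^-1.
    set w := _ - _.
    have -> : w = dl / k./2.+1%:R by rewrite /w sS; case: odd; ring.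
    have w1 : dl / k./2.+1%:R <= 1.
      by rewrite ler_pdivrMr// mul1r (le_trans dl1)// ler1n.
    (* As the side is at most 1 and [n >= 2], the volume is at most the squared side;
       [k.+1 <= 2 * k./2.+1] then produces the factor 4. *)
    rewrite prodr_const card_ord (le_trans (ler_wiXn2l (width0 _) w1 n1))//.
    rewrite [4 * _]mulrC -mulrA expr_div_n ler_wpM2l ?sqr_ge0//.
    rewrite ler_pdivlMr ?exprn_gt0// mulrC ler_pdivrMr ?exprn_gt0//.
    rewrite -natrX -natrX -natrM ler_nat.
    have : (k.+1 <= k./2.+1.*2)%N.
      by rewrite -{1}(odd_double_half k) doubleS; case: odd.
    by rewrite -leq_sqr -mul2n expnMn.
  apply: le_trans (ler_sum _ (fun k _ => vol (nat_of_ord k))) _.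
  rewrite -mulr_sumr.
  have := @sum_inv_sqr_le R N; have : 0 <= N%:R^-1 :> R by rewrite invr_ge0.
  set S := \sum_(k < N) _ => N0 SN.
  have S2 : S <= 2 by lra.
  have := ler_wpM2l (sqr_ge0 dl) S2; nra.
Qed.

(** * Almost sure admissibility under A2 and A3 *)

Section gossip.
Context {R : realType} {n : nat} (A : 'M[R]_n) (alpha beta gamma : R)
  (T Srep : nat -> R) {d : measure_display} {Omega : measurableType d}
  (P : probability Omega R) (Z : nat -> Omega -> Step n).
Hypothesis n0 : (0 < n)%N.
Hypothesis T01 : forall k, 0 < T k <= 1.
Hypothesis mZ : forall k (B : set (Step n)), measurable (Z k @^-1` B).
Hypothesis no_rep :
  forall k (i j : 'I_n), P [set w | step_ev (Z k w) i j = Rep] = 0%E.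
Hypothesis att_sym : forall k (i j : 'I_n),
  [set w | step_ev (Z k w) i j = Att] = [set w | step_ev (Z k w) j i = Att].

Let t k : R := T k * (1 - T k).

Let t_ge0 k : 0 <= t k.
Proof. by have /andP[T0 T1] := T01 k; rewrite mulr_ge0 ?subr_ge0// ltW. Qed.

(** A repulsion has probability zero by A2; an attraction paired with a neglect is impossible by
    A3. *)
Lemma prob_inadmissible k (c : outcome n) :
  ~~ admissible c -> P (Z k @^-1` outcome_event c) = 0%E.
Proof.
have repP i j : P (Z k @^-1` [set z | step_ev z i j = Rep]) = 0%E := no_rep k i j.
case: c => -[i j] [e e'] cP.
have [er|er] := eqVneq e Rep.
  apply/eqP; rewrite eq_le measure_ge0 andbT -(repP i j).
  by apply: le_measure; rewrite ?inE//; move=> w [<- <- e1 _]; rewrite /= e1.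
have [e'r|e'r] := eqVneq e' Rep.
  apply/eqP; rewrite eq_le measure_ge0 andbT -(repP j i).
  by apply: le_measure; rewrite ?inE//; move=> w [<- <- _ e1]; rewrite /= e1.
rewrite (_ : _ @^-1` _ = set0) ?measure0//; apply/seteqP; split => // w.
case=> ni nj ei ej; have := congr1 (@^~ w) (att_sym k i j) => /=.
rewrite -ni -nj ei ej => att; move: cP er e'r; rewrite /admissible /=.
case: e e' att {ei ej} => -[] // att _ _ _; suff: Neg = Att by [].
  by rewrite -att.
by rewrite att.
Qed.

Definition inadmissible_somewhere : set Omega :=
  [set w | exists k, ~~ admissible (outcome_of (Z k w))].

Lemma negligible_inadmissible : P.-negligible inadmissible_somewhere.
Proof.
have -> : inadmissible_somewhere =
    \bigcup_k (Z k @^-1` [set z | ~~ admissible (outcome_of z)]).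
  by apply/seteqP; split=> w [k]; [exists k|move=> _; exists k].
apply: negligible_bigcup => k; apply/negligibleP => //.
apply: (etrans (measure_outcome_split P Z mZ k _ _)) => //; apply: big1 => c _.
have [ca|ca] := boolP (admissible c).
  rewrite (_ : _ `&` _ = set0) ?measure0//; apply/seteqP; split => // w.
  by case=> /= + wc; rewrite wc ca.
apply/eqP; rewrite eq_le measure_ge0 andbT -(prob_inadmissible k c ca).
by apply: le_measure; rewrite ?inE//; apply: measurableI.
Qed.

(** * Pathwise bounds on an admissible sample point *)

Section path.
Context (k0 : nat) (x0 : 'I_n -> R) (w : Omega).
Hypothesis wP : ~ inadmissible_somewhere w.

Let V m := spread (traj T Srep Z k0 x0 w m).

Lemma spread_trajS m :
  V m - 2 * n%:R * t (k0 + m)%N * V m <= V m.+1 <= V m.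
Proof.
have ad : admissible (outcome_of (Z (k0 + m)%N w)).
  by apply: contrapT => /negP ad; apply: wP; exists (k0 + m)%N.
rewrite /V /= gossip_stepE spread_outcome_step//.
set i := _.1.1; set j := _.1.2; set x := traj _ _ _ _ _ _ _.
have ij := sqr_diff_le_spread x i j; have := sqr_ge0 (x i - x j).
rewrite -/(t _); have := t_ge0 (k0 + m)%N; have := spread_ge0 x.
set a := t _; set D := _ ^+ 2 in ij *; set v := spread x in ij *.
move=> v0 a0 D0; have n00 : 0 <= n%:R :> R by [].
have na := mulr_ge0 n00 a0.
case: eqP => _ /=; have := mulr_ge0 na D0; have := mulr_ge0 na v0;
  have := ler_wpM2l na ij; lra.
Qed.

Lemma spread_traj_noninc : {homo V : m m' / (m <= m')%N >-> m' <= m}.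
Proof.
apply: homo_leq => [x|y x z yx zy|m]; first exact: lexx.
  exact: le_trans zy yx.
by have /andP[] := spread_trajS m.
Qed.

(** Since [V] is nonincreasing, the loss at step [k] is at most [2 * n * t k] times the initial
    spread, so losses add up linearly and no product has to be estimated. *)
Lemma spread_traj_ge m :
  (1 - 2 * n%:R * \sum_(k0 <= k < k0 + m) t k) * spread x0 <= V m.
Proof.
elim: m => [|m IH].
  by rewrite addn0 big_geq// mulr0 subr0 mul1r.
have /andP[step _] := spread_trajS m; apply: le_trans step.
rewrite addnS big_nat_recr ?leq_addr//=.
have Vm := spread_traj_noninc _ _ (leq0n m).
have a0 : 0 <= n%:R * t (k0 + m)%N by rewrite mulr_ge0.
have := ler_wpM2l a0 Vm; rewrite {2}/V /=; move: IH.
set s := \sum_(_ <= _ < _) _; lra.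
Qed.

Lemma limn_esup_Hdiam_neq0 : 0 < spread x0 ->
  (forall m, \sum_(k0 <= k < k0 + m) t k <= (4 * n%:R)^-1) ->
  limn_esup (fun m => (Hdiam (traj T Srep Z k0 x0 w m))%:E) <> 0%E.
Proof.
move=> V0 small lim0.
have nR : 0 < n%:R :> R by rewrite ltr0n.
have Hm m : spread x0 / 2 <= n%:R ^+ 2 * Hdiam (traj T Srep Z k0 x0 w m) ^+ 2.
  apply: le_trans (spread_le_Hdiam_sqr _ n0); apply: le_trans (spread_traj_ge m).
  rewrite mulrC ler_wpM2r ?(ltW V0)//.
  have := ler_wpM2l (ltW nR) (small m).
  have -> : n%:R * (4 * n%:R)^-1 = 4^-1 :> R by field; rewrite gt_eqF.
  set s := \sum_(_ <= _ < _) _; lra.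
(* A diameter [h] below this has [h ^+ 2 <= h], hence [n^2 h^2 < spread x0 / 4], against [Hm]. *)
pose dl : R := Num.min 1 (spread x0 / (4 * n%:R ^+ 2)).
have dl0 : 0 < dl by rewrite lt_min ltr01 divr_gt0// mulr_gt0// exprn_gt0.
have := limn_esup_le_cvg (u := fun m => (Hdiam (traj T Srep Z k0 x0 w m))%:E)
  (l := 0%E).
rewrite lim0 lexx => /(_ isT) H0.
have {}H0 : (Hdiam (traj T Srep Z k0 x0 w m))%:E @[m --> \oo] --> (0%E : \bar R).
  by apply: H0 => m; rewrite lee_fin Hdiam_ge0.
have /H0[m _ /(_ _ (leqnn m)) /=] : nbhs (0%E : \bar R) [set y | (y < dl%:E)%E].
  by apply: lt_nbhsl; exact: dl0.
rewrite lte_fin lt_min => /andP[H1 Hs].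
have Hge := Hdiam_ge0 (traj T Srep Z k0 x0 w m) n0.
have := Hm m; move: Hs; rewrite ltr_pdivlMr; last by rewrite mulr_gt0// exprn_gt0.
move: Hge H1; set h := Hdiam _ => h0 h1 hs.
have n20 : 0 < n%:R ^+ 2 :> R by rewrite exprn_gt0.
have : h ^+ 2 <= h by rewrite expr2 ler_piMl// ltW.
move=> /(ler_wpM2l (ltW n20)); move: hs; set N2 := n%:R ^+ 2; lra.
Qed.

(** By monotonicity a single visit below a threshold persists; the countable family of thresholds
    suits a countable union of null events. *)
Lemma limn_esup_Hdiam_eq0 : (forall q, exists m, V m < q.+1%:R^-1) ->
  limn_esup (fun m => (Hdiam (traj T Srep Z k0 x0 w m))%:E) = 0%E.
Proof.
move=> V0; apply: (cvg_limn_einf_sup _).2.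
apply: cvg_EFin; first by near=> m.
apply/cvgr0Pnorm_lt => e e0.
have [q qe] : exists q, q.+1%:R^-1 < e ^+ 2.
  have /cvgr0Pnorm_lt/(_ (e ^+ 2)) := @cvg_harmonic R.
  rewrite exprn_gt0// => /(_ isT)[q _ /(_ q (leqnn q))] /=.
  by rewrite ger0_norm ?harmonic_ge0//; exists q.
have [m Vm] := V0 q; exists m => // m' /= mm'.
have H0 := Hdiam_ge0 (traj T Srep Z k0 x0 w m') n0.
rewrite ger0_norm// -(ltr_pXn2r (n := 2))// ?nnegrE// 1?ltW//.
apply: le_lt_trans (Hdiam_sqr_le_spread _ n0) _.
exact: le_lt_trans (spread_traj_noninc _ _ mm') (lt_trans Vm qe).
Unshelve. all: by end_near.
Qed.

End path.

(** * Decay of the expected spread and almost sure consensus *)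

Hypothesis A_stoch : stochastic A.
Hypothesis A_conn : weakly_connected A.
Hypothesis indep : mutually_independent P Z.
Hypothesis alpha0 : 0 < alpha.
Hypothesis prob_ev : forall k (i j i' j' : 'I_n) (e : evt),
  P [set w | step_node (Z k w) = i' /\ step_partner (Z k w) = j' /\
             step_ev (Z k w) i j = e] =
  (A i' j' / n%:R * evt_prob alpha beta gamma e)%:E.

Let p := outcome_prob P Z.

(** By A3 the attraction of [i] forces that of [j], so the joint event has the probability of the
    single one. *)
Lemma outcome_prob_attract k i j :
  p k (i, j, (Att, Att)) = A i j / n%:R * alpha.
Proof.
apply/EFin_inj; rewrite -outcome_probE// -(prob_ev k i j i j Att); congr (P _).
apply/seteqP; split => w /=; first by case=> <- <- ->.
rewrite /outcome_event /= /outcome_of; case=> -> [-> e1].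
have := congr1 (@^~ w) (att_sym k i j) => /= e12.
by congr (_, _, (_, _)) => //; rewrite -e12.
Qed.

Lemma expected_spread_step : exists2 kappa : R, 0 < kappa &
  forall k x, \sum_c p k c * spread (outcome_step (T k) (Srep k) c x) <=
    (1 - kappa * t k) * spread x.
Proof.
have [C C0 HC] := spread_le_sum_edges A A_stoch A_conn.
have nR : 0 < n%:R :> R by rewrite ltr0n.
(* The mean loss is [4 * n * t k] times [\sum_c F c], and this sum is at least
   [alpha / n * (spread x / C)]. *)
exists (4 * alpha / C) => [|k x]; first by rewrite divr_gt0// mulr_gt0.
pose F (c : outcome n) := p k c * ((c.2.1 == Att)%:R * (x c.1.1 - x c.1.2) ^+ 2).
have p0 c : 0 <= p k c by apply: outcome_prob_ge0.
have F0 c : 0 <= F c by rewrite mulr_ge0// mulr_ge0 ?sqr_ge0.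
have -> : \sum_c p k c * spread (outcome_step (T k) (Srep k) c x) =
    spread x - 4 * n%:R * t k * \sum_c F c.
  have {1}-> : spread x = \sum_c p k c * spread x.
    by rewrite -mulr_suml /p outcome_prob_sum1// mul1r.
  rewrite mulr_sumr -sumrB; apply: eq_bigr => c _.
  have [ca|ca] := boolP (admissible c).
    by rewrite spread_outcome_step// -/(t k) /F; ring.
  by rewrite /F /p /outcome_prob prob_inadmissible//= !mul0r mulr0 subr0.
have FQ : alpha / n%:R * \sum_i \sum_j A i j * (x i - x j) ^+ 2 <= \sum_c F c.
  have -> : \sum_c F c = \sum_ij \sum_ee F (ij, ee).
    by rewrite pair_bigA; apply: eq_bigr => -[].
  rewrite pair_bigA mulr_sumr; apply: ler_sum => -[i j] _ /=.
  rewrite (bigD1 (Att, Att))//= -[leLHS]addr0 lerD ?sumr_ge0//.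
  rewrite /F /= outcome_prob_attract mul1r le_eqVlt; apply/orP; left.
  by apply/eqP; ring.
have := HC x; rewrite mulrC -ler_pdivrMr// => {}HC.
have an0 : 0 <= alpha / n%:R by rewrite divr_ge0// ltW.
have := ler_wpM2l an0 HC => /le_trans/(_ FQ) low.
have nt0 : 0 <= 4 * n%:R * t k by rewrite mulr_ge0// mulr_ge0// ltW.
rewrite mulrBl mul1r lerB//; apply: le_trans (ler_wpM2l nt0 low).
rewrite le_eqVlt; apply/orP; left; apply/eqP.
by field; rewrite !gt_eqF.
Qed.

(** With [E] the expected spread, [kappa * t k * E k <= E k - E k.+1] telescopes; as [E] is
    nonincreasing, each [E k] on the left can be replaced by the last one. *)
Lemma expected_spread_le (k0 : nat) (x0 : 'I_n -> R) :
  exists2 kappa : R, 0 < kappa & forall m,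
    expect p (fun k => outcome_step (T k) (Srep k)) k0 x0 m spread *
      (1 + kappa * \sum_(k0 <= k < k0 + m) t k) <= spread x0.
Proof.
have [kappa kappa0 step] := expected_spread_step.
exists kappa => // m; pose E m :=
  expect p (fun k => outcome_step (T k) (Srep k)) k0 x0 m spread.
have p0 k c : 0 <= p k c by apply: outcome_prob_ge0.
have E0 l : 0 <= E l.
  rewrite -(mul0r (E l)) -expectZ; apply: le_expect => // x.
  by rewrite mul0r spread_ge0.
have ES l : E l.+1 <= (1 - kappa * t (k0 + l)%N) * E l.
  by rewrite -expectZ /E /=; apply: le_expect => // x; apply: step.
rewrite -/(E m); elim: m => [|m IH].
  by rewrite addn0 big_geq// mulr0 addr0 mulr1.
rewrite addnS big_nat_recr ?leq_addr//=; move: IH (ES m).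
set s := \sum_(_ <= _ < _) _; set a := t _ => IH ESm.
have s0 : 0 <= s by apply: sumr_ge0.
have kappa_ge0 := ltW kappa0.
have ka0 : 0 <= kappa * a := mulr_ge0 kappa_ge0 (t_ge0 _).
have ks0 : 0 <= kappa * s := mulr_ge0 kappa_ge0 s0.
have EE : E m.+1 <= E m.
  by rewrite (le_trans ESm)// ler_piMl// gerBl.
have := ler_wpM2l ka0 EE; have := ler_wpM2l ks0 EE.
lra.
Qed.

Lemma consensus_almost_surely (k0 : nat) (x0 : 'I_n -> R) :
  (\sum_(0 <= k <oo) (t k)%:E = +oo)%E ->
  P [set w | limn_esup (fun m => (Hdiam (traj T Srep Z k0 x0 w m))%:E) = 0%E]
    = 1%E.
Proof.
move=> too; set S := [set w | _].
have mS : measurable S by apply: measurable_limn_esup_Hdiam.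
suff nS : P.-negligible (~` S).
  rewrite -[S]setCK probability_setC; last exact: measurableC.
  by rewrite (measure_negligible (measurableC mS) nS) sube0.
(* On an admissible sample point, failure of consensus means that the spread stays above some
   [q.+1%:R^-1] forever. *)
pose large q := \bigcap_m
  in_traj T Srep Z k0 x0 [set x | q.+1%:R^-1 <= spread x] m.
apply: (negligibleS (A := inadmissible_somewhere `|` \bigcup_q large q)).
  move=> w Sw; have [wad|wad] := pselect (inadmissible_somewhere w); [by left|right].
  apply: contrapT => wl; apply/Sw/limn_esup_Hdiam_eq0 => // q.
  apply: contrapT => /forallNP Vq; apply: wl; exists q => // m _.
  by rewrite /in_traj /= leNgt; apply/negP.
apply: negligibleU; first exact: negligible_inadmissible.
apply: negligible_bigcup => q.
have mlarge : measurable (large q).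
  by apply: bigcap_measurable => // m _; apply: measurable_in_traj.
apply/negligibleP => //; apply/eqP; rewrite eq_le measure_ge0 andbT.
rewrite -(fineK (fin_num_measure P _ mlarge)) lee_fin.
set r := fine _.
have [kappa kappa0 Ele] := expected_spread_le k0 x0.
have rle m : r <= q.+1%:R *
    expect p (fun k => outcome_step (T k) (Srep k)) k0 x0 m spread.
  rewrite -lee_fin /r (fineK (fin_num_measure P _ mlarge)).
  rewrite -[q.+1%:R]invrK.
  apply: le_trans (traj_markov T Srep P Z mZ k0 x0 indep spread m _ _ _) => //.
  - apply: le_measure; rewrite ?inE//; first exact: measurable_in_traj.
    by move=> w /(_ m I).
  - exact: spread_ge0.
rewrite leNgt; apply/negP => r0.
(* For this block sum [s], [r * (1 + kappa * s) <= q.+1 * spread x0 <= r * kappa * s], which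
   contradicts [0 < r]. *)
have [m] := nneseries_dvg_ge t (q.+1%:R * spread x0 / (r * kappa)) k0 t_ge0 too.
rewrite ler_pdivrMr ?mulr_gt0//; set s := \sum_(_ <= _ < _) _ => sbig.
have s0 : 0 <= s by apply: sumr_ge0.
have ks : 0 <= 1 + kappa * s by rewrite addr_ge0// mulr_ge0// ltW.
have := ler_wpM2r ks (rle m); rewrite -mulrA.
have q0 : 0 <= q.+1%:R :> R by [].
have := ler_wpM2l q0 (Ele m); rewrite -/s; move: sbig r0.
lra.
Qed.

End gossip.

Theorem theorem3 (R : realType) (n : nat) (A : 'M[R]_n)
    (alpha beta gamma : R) (T Srep : nat -> R)
    (d : measure_display) (Omega : measurableType d) (P : probability Omega R)
    (Z : nat -> Omega -> Step n) :
  (3 <= n)%N ->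
  stochastic A ->
  0 <= alpha -> 0 <= beta -> 0 <= gamma -> alpha + beta + gamma = 1 ->
  (forall k, 0 < T k <= 1) ->
  (forall k, 0 < Srep k) ->
  (* measurability of the step outcomes (discrete sigma-algebra on Step n) *)
  (forall k (B : set (Step n)), measurable (Z k @^-1` B)) ->
  (* independence across times *)
  mutually_independent P Z ->
  (* node i uniform, then pair (i,j) with probability a_ij *)
  (forall k (i j : 'I_n),
     P [set w | step_node (Z k w) = i /\ step_partner (Z k w) = j] =
     (A i j / n%:R)%:E) ->
  (* node events: probability alpha/beta/gamma, independent of pair selection *)
  (forall k (i j i' j' : 'I_n) (e : evt),
     P [set w | step_node (Z k w) = i' /\ step_partner (Z k w) = j' /\
                step_ev (Z k w) i j = e] =
     (A i' j' / n%:R * evt_prob alpha beta gamma e)%:E) ->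
  (* A1 *)
  weakly_connected A ->
  (* A2 *)
  (forall k (i j : 'I_n), P [set w | step_ev (Z k w) i j = Rep] = 0%E) ->
  (* A3 *)
  (forall k (i j : 'I_n),
     [set w | step_ev (Z k w) i j = Att] = [set w | step_ev (Z k w) j i = Att]) ->
  (* monotone step sizes *)
  ((forall k, T k.+1 <= T k) \/ (forall k, T k <= T k.+1)) ->
  (* (i) *)
  ((\sum_(0 <= k <oo) ((T k * (1 - T k))%:E) < +oo)%E ->
   exists K0 : nat, forall k0 : nat, (K0 <= k0)%N ->
     ae_lebesgue (fun x0 : 'I_n -> R =>
       P [set w | limn_esup (fun m => (Hdiam (traj T Srep Z k0 x0 w m))%:E) = 0%E]
       = 0%E))
  /\
  (* (ii) *)
  (0 < alpha ->
   (\sum_(0 <= k <oo) ((T k * (1 - T k))%:E) = +oo)%E ->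
   forall (k0 : nat) (x0 : 'I_n -> R),
     P [set w | limn_esup (fun m => (Hdiam (traj T Srep Z k0 x0 w m))%:E) = 0%E]
     = 1%E).
Proof.
move=> n3 A_stoch alpha0 _ _ _ T01 _ mZ indep _ prob_ev A_conn no_rep att_sym _.
have n0 : (0 < n)%N by apply: leq_trans n3.
have t0 k : 0 <= T k * (1 - T k).
  by have /andP[T0 T1] := T01 k; rewrite mulr_ge0 ?subr_ge0// ltW.
split=> [fin|apos too k0 x0]; last exact: (consensus_almost_surely A alpha beta gamma).
(* A tail below [1 / (4 n)] limits the total loss to half of the initial spread. *)
have n4 : 0 < (4 * n%:R)^-1 :> R by rewrite invr_gt0 mulr_gt0// ltr0n.
have [K0 tail] := nneseries_tail_le _ _ t0 n4 fin.
exists K0 => k0 K0k eps eps0.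
have [a [b [ab [diag vol]]]] := lebesgue_null_diagonal n (ltnW n3) eps eps0.
(* The cover of the diagonal serves for the exceptional initial values: off the diagonal, consensus
   can only occur on inadmissible sample points. *)
exists a, b; split=> //; split=> // x Qx; apply: diag => i j.
have [x0|x0] := eqVneq (spread x) 0.
  have := sqr_diff_le_spread x i j; rewrite x0 => xij.
  apply/eqP; rewrite -subr_eq0 -sqrf_eq0 eq_le sqr_ge0 andbT; lra.
case: Qx; apply: measure_negligible; first exact: measurable_limn_esup_Hdiam.
apply: negligibleS (negligible_inadmissible P Z mZ no_rep att_sym) => w lim0.
apply: contrapT => wad.
apply: (limn_esup_Hdiam_neq0 T Srep Z n0 T01 k0 x w wad _ _ lim0).
  by rewrite lt_neqAle eq_sym x0 spread_ge0.
by move=> m; apply: tail.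
Qed.
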